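(* The sequence $\{\mathit{pa}(n)\}_{n\ge 1}$ is strictly increasing, where $\mathit{pa}(n)$ is the number of unlimited parity alternating partitions of $n$.
   Context: A partition of a positive integer $n$ is a weakly decreasing sequence of positive integers with sum $n$. An unlimited parity alternating partition is a partition whose different parts alternate in parity: if the distinct part sizes are $d_1>d_2>\cdots>d_r$, then $d_i$ and $d_{i+1}$ have different parities for every $i$ (parts may be repeated). $\mathit{pa}(n)$ is the number of such partitions of $n$. *)

(* Defs.v *)
From mathcomp Require Import all_boot.

Set Implicit Arguments.
Unset Strict Implicit.
Unset Printing Implicit Defensive.

Definition is_partition (n : nat) (s : seq nat) : bool :=
  [&& sorted geq s, all (leq 1) s & sumn s == n].

(* For a weakly decreasing s, undup s lists the distinct part sizes
   d_1 > d_2 > ... > d_r in this order. *)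
Definition parity_alternating (s : seq nat) : bool :=
  sorted (fun x y => odd x != odd y) (undup s).

(* A partition of n has at most n parts, each at most n, so the partitions of n
   all live in the finite type of sequences of length <= n over {0, ..., n}
   (see partition_bseq). *)
Definition pa_partitions (n : nat) : {set n.-bseq 'I_n.+1} :=
  [set s : n.-bseq 'I_n.+1 |
    is_partition n (map val s) && parity_alternating (map val s)].

Definition pa (n : nat) : nat := #|pa_partitions n|.

Lemma partition_bseq (n : nat) (s : seq nat) :
  is_partition n s -> exists t : n.-bseq 'I_n.+1, map val t = s.
Proof.
case/and3P=> _ s_gt0 /eqP sum_s.
have size_le : size s <= n.
  rewrite -{}sum_s; elim: s s_gt0 => //= x s IHs /andP[x_gt0 /IHs].
  exact: (leq_add x_gt0).
have s_lt x : x \in s -> x < n.+1.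
  rewrite ltnS -{}sum_s => {s_gt0 size_le}; elim: s => //= y s IHs.
  rewrite inE => /predU1P[-> | /IHs le_x]; first exact: leq_addr.
  exact: leq_trans le_x (leq_addl _ _).
have size_t : size (map (@inord n) s) <= n by rewrite size_map.
exists (Bseq size_t); rewrite /= -map_comp -[RHS]map_id.
by apply/eq_in_map => x /s_lt x_lt /=; rewrite inordK.
Qed.

(* Main.v *)
Require Import Defs.
From mathcomp Require Import all_boot.
From mathcomp Require Import zify.

(** The map [grow] is an injection from the parity alternating partitions of
    [n] to those of [n + 1], defined by cases on the smallest part [d].
    - If [d] is [1] or even, append a part [1].
    - If [d >= 3] is odd and the largest part is repeated, add [1] to one copy
      of the largest part.
    - If [d >= 3] is odd and the largest part [x] occurs once, followed by [y],
      then [x - y] is odd: replace [x] by [y] and append [(x - y + 1) / 2]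
      parts [2]. A single part [x] is replaced by [(x + 1) / 2] parts [2].
    The smallest part of the image ([1], odd and at least [3], or [2]) tells
    the cases apart, and in the last one the number of parts [2] gives back
    [x]. Every image has at least two parts, so the partition of [n + 1] into
    one part is missed. *)

(** A condition on adjacent parts only, combining weak decrease with parity alternation. This avoids
    [undup] and lets [grow] be checked at the places where it modifies the list. *)
Definition pa_rel : rel nat :=
  fun x y => (x == y) || (y < x) && (odd x != odd y).

Definition is_pa (n : nat) (s : seq nat) : bool :=
  [&& sorted pa_rel s, all (leq 1) s & sumn s == n].

(** In a weakly decreasing list, a further copy of the head forces the next entry to be such a
    copy. *)
Lemma undup_sorted_cons (x y : nat) (s : seq nat) :
  path geq x (y :: s) ->
  undup [:: x, y & s] = if x == y then undup (y :: s) else x :: undup (y :: s).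
Proof.
move=> le_s; rewrite [LHS]/=.
case: eqVneq => [->|neq_xy]; first by rewrite mem_head.
case: ifP => // x_in.
have /allP/(_ _ x_in) : all (geq y) (y :: s).
  apply/andP; split=> //=; apply: (@order_path_min _ geq) (proj2 (andP le_s)).
  by move=> a b c /= le_ab le_ca; apply: leq_trans le_ca le_ab.
by case/andP: le_s => /= *; lia.
Qed.

Lemma undup_sorted_head (x : nat) (s : seq nat) :
  path geq x s -> exists u, undup (x :: s) = x :: u.
Proof.
elim: s x => [|y s IHs] x le_s; first by exists [::].
have [u eq_u] := IHs y (proj2 (andP le_s)).
by rewrite undup_sorted_cons // eq_u; case: eqVneq => [->|_]; eexists.
Qed.

Lemma sorted_pa_relE (s : seq nat) :
  sorted pa_rel s = sorted geq s && parity_alternating s.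
Proof.
rewrite /parity_alternating; case: s => // x s.
elim: s x => [|y s IHs] x //.
have [le_s|nle_s] := boolP (path geq x (y :: s)); last first.
  rewrite [sorted geq _](negbTE nle_s) andFb.
  apply: contraNF nle_s => /=; rewrite -/(sorted pa_rel (y :: s)) IHs.
  case/andP=> r_xy /andP[/= -> _]; rewrite andbT.
  by move: r_xy; rewrite /pa_rel; lia.
have le_yx : y <= x by case/andP: le_s.
have le_ys : path geq y s by case/andP: le_s.
have [u eq_u] := undup_sorted_head _ _ le_ys.
rewrite undup_sorted_cons // [sorted geq _]le_s andTb.
rewrite [LHS](_ : _ = pa_rel x y && sorted pa_rel (y :: s)) // IHs.
rewrite [sorted geq _]le_ys andTb eq_u /pa_rel.
by case: eqVneq => //= neq_xy; rewrite ltn_neqAle eq_sym neq_xy le_yx.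
Qed.

Lemma is_paE (n : nat) (s : seq nat) :
  is_pa n s = is_partition n s && parity_alternating s.
Proof. by rewrite /is_pa sorted_pa_relE /is_partition andbAC. Qed.

Definition grow (s : seq nat) : seq nat :=
  if (last 0 s == 1) || ~~ odd (last 0 s) then rcons s 1 else
  match s with
  | [:: x, y & s'] =>
      if x == y then [:: x.+1, y & s']
      else [:: y, y & s'] ++ nseq (x - y).+1./2 2
  | [:: x] => nseq x.+1./2 2
  | [::] => [::]
  end.

(** In the even case, [c] parts [2] came from a largest part [y + 2c - 1] when another part [y]
    remains, and from the single part [2c - 1] otherwise. *)
Definition shrink (t : seq nat) : seq nat :=
  if last 0 t == 1 then take (size t).-1 t
  else if odd (last 0 t) then
    if t is x :: t' then x.-1 :: t' else [::]
  else
    if [seq z <- t | z != 2] is y :: t' then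
      (y + (count_mem 2 t).*2).-1 :: t'
    else [:: (size t).*2.-1].

Lemma pa_rel_last_min (x : nat) (s : seq nat) :
  path pa_rel x s -> all (leq (last x s)) (x :: s).
Proof.
elim: s x => [|y s IHs] x /=; first by rewrite leqnn.
case/andP=> r_xy /IHs/=/andP[le_y ->]; rewrite le_y !andbT.
by move: r_xy; rewrite /pa_rel; lia.
Qed.

Lemma path_nseq (e : rel nat) (x y k : nat) :
  e x y -> e y y -> path e x (nseq k y).
Proof. by move=> e_xy e_yy; elim: k x e_xy => //= k IHk x ->; apply: IHk. Qed.

(** The branches of [grow] with the halvings solved: a single part is [2k + 3], and a largest part
    occurring once above [y] is [y + 2k + 1]. *)
Variant grow_spec (s : seq nat) : seq nat -> Prop :=
  | GrowOne of (last 0 s == 1) || ~~ odd (last 0 s) : grow_spec s (rcons s 1)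
  | GrowTop x s' of s = [:: x, x & s'] & odd (last 0 s) & all (leq 3) s :
      grow_spec s [:: x.+1, x & s']
  | GrowTwos y k s' of s = [:: (y + k.*2).+1, y & s'] & odd (last 0 s)
      & all (leq 3) s :
      grow_spec s ([:: y, y & s'] ++ nseq k.+1 2)
  | GrowSingle k of s = [:: k.*2.+3] : grow_spec s (nseq k.+2 2).

Lemma growP (n : nat) (s : seq nat) :
  0 < n -> is_pa n s -> grow_spec s (grow s).
Proof.
move=> n_gt0 /and3P[s_pa _ /eqP sum_s].
rewrite /grow; case: ifP => [|/negbT]; first exact: GrowOne.
rewrite negb_or negbK => /andP[last_neq1 last_odd].
case: s s_pa last_neq1 last_odd sum_s => [//|x [|y s]].
  move=> _ x_neq1 x_odd _; rewrite /= in x_neq1 x_odd.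
  have [k ->] : exists k, x = k.*2.+3 by exists x./2.-1; lia.
  rewrite (_ : _./2 = k.+2); last by lia.
  exact: GrowSingle.
move=> s_pa last_neq1 last_odd _.
(* The last part is the smallest; being odd and different from [1], it is at least [3]. *)
have ge3 : all (leq 3) [:: x, y & s].
  apply: sub_all (pa_rel_last_min _ _ s_pa) => z /=.
  by move: last_neq1 last_odd => /=; lia.
have /andP[r_xy _] := s_pa.
case: eqVneq r_xy => [eq_xy|neq_xy] r_xy.
  by subst y; apply: GrowTop.
have [k def_x] : exists k, x = (y + k.*2).+1.
  by exists (x - y)./2; move: r_xy neq_xy; rewrite /pa_rel; lia.
rewrite {}def_x in last_odd ge3 *.
rewrite (_ : _./2 = k.+1); last by lia.
exact: GrowTwos.
Qed.

Lemma grow_is_pa (n : nat) (s : seq nat) :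
  0 < n -> is_pa n s -> is_pa n.+1 (grow s).
Proof.
move=> n_gt0 s_pa; have /and3P[s_r s_pos /eqP sum_s] := s_pa.
case: (growP n s n_gt0 s_pa).
- move=> last_s; rewrite /is_pa all_rcons s_pos sumn_rcons sum_s addn1 eqxx.
  case: s s_r s_pos last_s {s_pa sum_s} => // x s /= s_r /andP[x_pos s_pos] last_s.
  rewrite andbT rcons_path s_r /= /pa_rel.
  (* Positivity rules out a last part [0], so it is either [1] or a larger even number, and [1] may
     follow it. *)
  have: all (leq 1) (x :: s) by rewrite /= x_pos.
  move/allP/(_ _ (mem_last x s)); move: last_s.
  by case: (last x s) => [|[|z]] //=; case: (odd z).
- move=> x s' def_s _ _; rewrite {s s_pa}def_s /= in s_r s_pos sum_s *.
  rewrite /is_pa /=; case/andP: s_r => _ ->; case/and3P: s_pos => _ -> ->.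
  by rewrite /pa_rel; lia.
- move=> y k s' def_s last_s ge3.
  rewrite {s s_pa}def_s /= in s_r s_pos sum_s last_s ge3 *.
  case/andP: s_r => _ s_r; case/andP: s_pos => y_pos s_pos.
  case/and3P: ge3 => _ y_ge3 s_ge3.
  have last_ge3 : 2 < last y s'.
    have /allP: all (leq 3) (y :: s') by rewrite /= y_ge3.
    by apply; apply: mem_last.
  (* The junction with the new parts: an odd part of size at least [3] may precede [2]. *)
  have last_r : pa_rel (last y s') 2 by rewrite /pa_rel last_s; lia.
  rewrite /is_pa /= cat_path s_r /= last_r path_nseq // all_cat /= all_nseq.
  rewrite sumn_cat /= sumn_nseq y_pos s_pos orbT {1}/pa_rel eqxx /=.
  by apply/eqP; lia.
- move=> k def_s; rewrite {s s_pa s_r s_pos}def_s /= in sum_s *.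
  by rewrite /is_pa /= path_nseq // all_nseq orbT sumn_nseq; lia.
Qed.

Lemma size_grow (n : nat) (s : seq nat) :
  0 < n -> is_pa n s -> 1 < size (grow s).
Proof.
move=> n_gt0 s_pa; case: (growP n s n_gt0 s_pa) => //.
move=> _; rewrite size_rcons; case/and3P: s_pa => _ _.
by case: s => //= /eqP; lia.
Qed.

Lemma growK (n : nat) :
  0 < n -> {in is_pa n, cancel grow shrink}.
Proof.
move=> n_gt0 s s_pa; case: (growP n s n_gt0 s_pa).
- by move=> _; rewrite /shrink last_rcons eqxx size_rcons -cats1 take_size_cat.
- move=> x s' def_s last_s /allP ge3; rewrite /shrink.
  have := ge3 (last 0 s); rewrite def_s /= in last_s *; rewrite last_s.
  by move=> /(_ (mem_last x (x :: s'))); case: eqP => // ->.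
- move=> y k s' def_s _; rewrite {}def_s => /andP[_ ge3].
  (* The old parts are all at least [3], so filtering out [2] recovers exactly them, and the count
     of [2] is exactly [k + 1]. *)
  have neq2 : all (predC1 2) [:: y, y & s'].
    apply: sub_all (_ : all (leq 3) _) => [z /=|]; first by lia.
    by case/andP: ge3 => /= ->.
  have notin2 : 2 \notin [:: y, y & s'] by rewrite -has_pred1 -all_predC.
  have last2 z : last z (nseq k.+1 2) = 2 by elim: k {s_pa} z => //= k IHk z.
  rewrite /shrink last_cat last2 filter_cat (all_filterP neq2) filter_nseq.
  rewrite cats0 count_cat (count_memPn notin2) count_nseq [_ == 1]/= [odd _]/=.
  by rewrite mul1n doubleS !addnS.
- move=> k ->; have last2 z : last z (nseq k.+2 2) = 2.
    by elim: k {s_pa} z => //= k IHk z.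
  rewrite /shrink last2 filter_nseq size_nseq /=.
  by congr [:: _]; lia.
Qed.

(** Partitions of [n] and of [n + 1] live in different finite types; as plain lists they can be
    compared through [grow]. *)
Definition pa_seqs (n : nat) : seq (seq nat) :=
  [seq map val s | s : n.-bseq 'I_n.+1 <- enum (pa_partitions n)].

Lemma size_pa_seqs (n : nat) : size (pa_seqs n) = pa n.
Proof. by rewrite size_map -cardE. Qed.

Lemma pa_seqs_uniq (n : nat) : uniq (pa_seqs n).
Proof.
rewrite map_inj_uniq ?enum_uniq // => s t /(inj_map val_inj) eq_st.
exact: val_inj.
Qed.

Lemma mem_pa_seqs (n : nat) (s : seq nat) : (s \in pa_seqs n) = is_pa n s.
Proof.
rewrite is_paE; apply/mapP/idP => [[t]|s_pa].
  by rewrite mem_enum inE => t_pa ->.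
have [t def_s] := partition_bseq (proj1 (andP s_pa)).
by exists t => //; rewrite mem_enum inE def_s.
Qed.

Lemma pa_ltS (n : nat) : 0 < n -> pa n < pa n.+1.
Proof.
move=> n_gt0; rewrite -!size_pa_seqs -(size_map grow).
(* Adjoining the one-part partition of [n + 1] to the images of [grow] accounts for the strict
   inequality. *)
rewrite -[X in X <= _]/(size ([:: n.+1] :: map grow (pa_seqs n))).
apply: uniq_leq_size => [|t].
  rewrite cons_uniq map_inj_in_uniq ?pa_seqs_uniq ?andbT; last first.
    by apply: (can_in_inj (g := shrink)) => s; rewrite mem_pa_seqs; apply: growK.
  apply/mapP=> -[s]; rewrite mem_pa_seqs => s_pa eq_s.
  by have := size_grow _ _ n_gt0 s_pa; rewrite -eq_s.
rewrite inE mem_pa_seqs => /predU1P[->|/mapP[s]].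
  by rewrite /is_pa /= addn0 eqxx.
by rewrite mem_pa_seqs => s_pa ->; apply: grow_is_pa.
Qed.

Theorem theorem2p1 (m n : nat) (m_gt0 : 0 < m) (lt_mn : m < n) : pa m < pa n.
Proof.
elim: n lt_mn => // n IHn; rewrite ltnS leq_eqVlt => /predU1P[<-|lt_mn].
  exact: pa_ltS.
by apply: ltn_trans (IHn lt_mn) (pa_ltS _ _); apply: ltn_trans lt_mn.
Qed.
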